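(* Let $|||\cdot|||$ be a symmetric norm on $\mathcal{M}_n$ and let $A,B\in\mathcal{M}_n$ with $B$ invertible. Then for all $r,p>0$ and $q<0$ with $\frac1r=\frac1p+\frac1q$, $$\frac1r\,|||\,|AB|^r\,|||\ \ge\ \frac1p\,|||\,|A|^p\,|||+\frac1q\,|||\,|B|^q\,|||.$$
   Context: $\mathcal{M}_n$ is the set of $n\times n$ (complex) matrices; $|X|=(X^*X)^{1/2}$, with powers taken by functional calculus. A symmetric gauge function is a norm $\Phi$ on $\mathbb{R}^n$, invariant under permutations of coordinates and under sign changes of coordinates, with $\Phi(1,0,\ldots,0)=1$. A symmetric norm on $\mathcal{M}_n$ is a norm of the form $|||A|||=\Phi(s(A))$, where $\Phi$ is a symmetric gauge function and $s(A)=(s_1(A),\ldots,s_n(A))$ is the vector of singular values of $A$ in decreasing order. *)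

(* Defs.v *)
From mathcomp Require Import all_boot all_order all_fingroup all_algebra.
From mathcomp Require Import complex.
From mathcomp Require Import all_classical all_reals all_analysis.

Set Implicit Arguments.
Unset Strict Implicit.
Unset Printing Implicit Defensive.

Import Order.TTheory GRing.Theory Num.Theory.

Local Open Scope ring_scope.
Local Open Scope complex_scope.
Local Open Scope sesquilinear_scope.

(* [absv] is the absolute value of the scalars. Nonnegativity of [N] follows
   from the three conditions. *)
Definition is_norm (R : numDomainType) (K : pzRingType) (absv : K -> R)
    (V : lmodType K) (N : V -> R) : Prop :=
  [/\ forall x y, N (x + y) <= N x + N y,
      forall (c : K) x, N (c *: x) = absv c * N x
    & forall x, N x = 0 -> x = 0].

(* [delta_mx 0 ord0] is the row vector (1, 0, ..., 0). *)
Definition symmetric_gauge (R : numDomainType) (n : nat)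
    (Phi : 'rV[R]_n.+1 -> R) : Prop :=
  [/\ is_norm Num.norm Phi,
      forall (s : 'S_n.+1) (x : 'rV[R]_n.+1), Phi (col_perm s x) = Phi x,
      forall (e : 'I_n.+1 -> bool) (x : 'rV[R]_n.+1),
        Phi (\row_j ((-1) ^+ e j * x 0 j)) = Phi x
    & Phi (delta_mx 0 ord0) = 1].

Section FunctionalCalculus.

Variables (R : realType) (n : nat).
Implicit Types (f : R -> R) (H X : 'M[R[i]]_n).

(* Functional calculus for a Hermitian matrix: if
   H = P^-1 *m diag_mx d *m P is the spectral decomposition of H, with P
   unitary and d real, then f(H) = P^-1 *m diag_mx (f d) *m P. Meaningful only
   for Hermitian H. *)
Definition herm_fun f H : 'M[R[i]]_n :=
  invmx (spectralmx H)
    *m diag_mx (map_mx (fun z : R[i] => (f (complex.Re z))%:C) (spectral_diag H))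
    *m spectralmx H.

Definition mxabs X : 'M[R[i]]_n := herm_fun Num.sqrt (X ^t* *m X).

(* |X|^p. As 0 `^ p = 0 for p > 0, this covers singular X when p > 0; for
   p < 0 it is the usual power only if X is invertible. *)
Definition mxabs_pow X (p : R) : 'M[R[i]]_n :=
  herm_fun (fun t => t `^ p) (mxabs X).

(* The eigenvalues of |X|, with multiplicity, in decreasing order. *)
Definition singular_values X : 'rV[R]_n :=
  \row_(j < n)
    nth 0 (sort >=%R [seq complex.Re (spectral_diag (mxabs X) 0 k) | k : 'I_n])
        j.

End FunctionalCalculus.

Definition symmetric_norm (R : realType) (n : nat)
    (N : 'M[R[i]]_n.+1 -> R) : Prop :=
  is_norm (@ComplexField.Normc.normc R) N /\
  exists Phi : 'rV[R]_n.+1 -> R,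
    symmetric_gauge Phi /\ forall A, N A = Phi (singular_values A).

(* Main.v *)
(* Let [a], [g], [b] be the singular values of [A], [A B] and [B], with [a] and
   [g] decreasing and [b] increasing. Since [A = (A B) B^-1], Horn's inequality
   [prod_(i < k) a_i <= prod_(i < k) g_i / b_i] holds for all [k]; it comes from
   an expansion of [det (W^* D W)] in the spirit of Cauchy-Binet, which bounds
   this determinant by [det (W^* W)] times extremal products of entries of the
   diagonal matrix [D]. Hence [a^p] is weakly majorized by [g^p b^-p], which is
   at most [(p / r) g^r - (p / q) b^q] by Young's inequality, and symmetric gauge
   functions are monotone for weak majorization. *)
Require Import Defs.
From mathcomp Require Import all_boot all_order all_fingroup all_algebra.
From mathcomp Require Import complex ring lra.
From mathcomp Require Import all_classical all_reals all_analysis.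

Set Implicit Arguments.
Unset Strict Implicit.
Unset Printing Implicit Defensive.

Import Order.TTheory GRing.Theory Num.Theory.

Local Open Scope ring_scope.
Local Open Scope complex_scope.
Local Open Scope sesquilinear_scope.

(** * Symmetric gauge functions and weak majorization *)

Lemma gauge_convex (R : numDomainType) n (Phi : 'rV[R]_n.+1 -> R) (t M : R)
    (x y : 'rV[R]_n.+1) :
  symmetric_gauge Phi -> 0 <= t <= 1 -> Phi x <= M -> Phi y <= M ->
  Phi ((1 - t) *: x + t *: y) <= M.
Proof.
case=> -[tri hom _] _ _ _ /andP[t0 t1] xM yM.
apply: le_trans (tri _ _) _; rewrite !hom !ger0_norm ?subr_ge0//.
have -> : M = (1 - t) * M + t * M by rewrite -mulrDl subrK mul1r.
by rewrite lerD// ler_wpM2l// subr_ge0.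
Qed.

(* Induction on the number of coordinates where [x] and [y] differ. *)
Lemma gauge_weak_majorization (R : realFieldType) n (Phi : 'rV[R]_n.+1 -> R)
    (x y : 'rV[R]_n.+1) :
  symmetric_gauge Phi ->
  (forall i, 0 <= x 0 i) ->
  (forall i j : 'I_n.+1, (i <= j)%N -> x 0 j <= x 0 i) ->
  (forall k, (k <= n.+1)%N ->
    \sum_(j : 'I_n.+1 | (j < k)%N) x 0 j <=
    \sum_(j : 'I_n.+1 | (j < k)%N) y 0 j) ->
  Phi x <= Phi y.
Proof.
move=> hPhi x0 xdecr; have [_ Phiperm Phisign _] := hPhi.
have [m] := ubnP #|[pred i | x 0 i != y 0 i]|.
elim: m y => // m IHm y; rewrite ltnS => le_m xy.
(* One induction step: [y'] keeps the agreements of [y] with [x] and gains a new one at [i]. *)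
have step (y' : 'rV[R]_n.+1) i : Phi y' <= Phi y -> x 0 i != y 0 i ->
    x 0 i = y' 0 i -> (forall l, x 0 l = y 0 l -> y' 0 l = y 0 l) ->
    (forall k, (k <= n.+1)%N ->
      \sum_(j : 'I_n.+1 | (j < k)%N) x 0 j <=
      \sum_(j : 'I_n.+1 | (j < k)%N) y' 0 j) ->
    Phi x <= Phi y.
  move=> Phiy' dxyi xy'i y'E xy'; apply: le_trans Phiy'; apply: IHm => //.
  apply: leq_trans le_m; apply: proper_card; apply/properP; split; last first.
    by exists i; rewrite !inE//= -xy'i eqxx.
  apply/fintype.subsetP => l; rewrite !inE; apply: contraNneq => xyl.
  by rewrite y'E -xyl.
have [/existsP[j0 yxj0]|/existsPn xley] := boolP [exists j, y 0 j < x 0 j].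
- (* A transfer of mass from [i] to [j]: [y'] is a convex combination of [y]
     and of its image under the transposition of [i] and [j]. *)
  have [j yxj jmin] :=
    @arg_minnP _ j0 (fun j => y 0 j < x 0 j) (@nat_of_ord _) yxj0.
  have xley (l : 'I_n.+1) : (l < j)%N -> x 0 l <= y 0 l.
    by move=> lj; rewrite leNgt; apply/negP => /jmin; rewrite leqNgt lj.
  (* If [y] were at most [x] everywhere before [j], the partial sums through [j] would contradict
     [xy]. *)
  have [i ij xyi] : exists2 i : 'I_n.+1, (i < j)%N & x 0 i < y 0 i.
    have [/exists_inP//|/exists_inPn xgey] :=
      boolP [exists (i : 'I_n.+1 | (i < j)%N), x 0 i < y 0 i].
    have := xy j.+1 (ltn_ord j); rewrite leNgt; case/negP.
    rewrite (bigD1 j)//= [ltRHS](bigD1 j)//= ltr_leD// ler_sum// => l.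
    rewrite ltnS => /andP[lj nlj]; rewrite leNgt; apply: xgey.
    by rewrite unfold_in ltn_neqAle lj andbT.
  have xij : x 0 j <= x 0 i by apply: xdecr; apply: ltnW.
  have dyij : 0 < y 0 i - y 0 j by rewrite subr_gt0; lra.
  (* The largest transfer overshooting neither [x 0 i] nor [x 0 j]; it creates an agreement at [i]
     or at [j]. *)
  pose d := Num.min (y 0 i - x 0 i) (x 0 j - y 0 j).
  have d0 : 0 <= d by rewrite le_min !subr_ge0 !ltW.
  have di : d <= y 0 i - x 0 i by rewrite ge_min lexx.
  have dj : d <= x 0 j - y 0 j by rewrite ge_min lexx orbT.
  pose t := d / (y 0 i - y 0 j).
  have tE : t * (y 0 i - y 0 j) = d by rewrite divfK// gt_eqF.
  pose y' := (1 - t) *: y + t *: col_perm (tperm i j) y.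
  have nij : (i == j) = false by apply/eqP => ijE; rewrite ijE ltnn in ij.
  have y'i : y' 0 i = y 0 i - d by rewrite !mxE tpermL -tE; ring.
  have y'j : y' 0 j = y 0 j + d by rewrite !mxE tpermR -tE; ring.
  have y'l l : l != i -> l != j -> y' 0 l = y 0 l.
    by move=> li lj; rewrite !mxE tpermD 1?eq_sym//; ring.
  have Phiy' : Phi y' <= Phi y.
    apply: gauge_convex => //; last by rewrite Phiperm.
    apply/andP; split; first by rewrite divr_ge0// ltW.
    by rewrite ler_pdivrMr// mul1r; lra.
  have y'E l : x 0 l = y 0 l -> y' 0 l = y 0 l.
    move=> xyl; apply: y'l; apply/eqP => lE; move: xyl; rewrite lE; lra.
  have xy' k : (k <= n.+1)%N ->
      \sum_(l : 'I_n.+1 | (l < k)%N) x 0 l <=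
      \sum_(l : 'I_n.+1 | (l < k)%N) y' 0 l.
    (* Before [j], [y'] dominates [x] entrywise; past [j], the sum contains both [i] and [j] and the
       transfer cancels. *)
    move=> kn; have [kj|jk] := leqP k j.
      apply: ler_sum => l lk; have lj := leq_trans lk kj.
      have [->|li] := eqVneq l i; first by rewrite y'i; lra.
      rewrite y'l ?xley//; apply: contraTneq lj => ->; by rewrite ltnn.
    apply: le_trans (xy k kn) _.
    rewrite (bigD1 i) ?(ltn_trans ij)//= [leRHS](bigD1 i) ?(ltn_trans ij)//=.
    rewrite (bigD1 j) ?jk 1?eq_sym ?nij//=.
    rewrite [X in _ <= _ + X](bigD1 j) ?jk 1?eq_sym ?nij//=.
    rewrite y'i y'j [X in _ <= _ + (_ + X)](eq_bigr (y 0)).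
      by rewrite le_eqVlt; apply/orP; left; apply/eqP; ring.
    by move=> l /andP[/andP[_ li] lj]; rewrite y'l.
  have [dE|dE] : d = y 0 i - x 0 i \/ d = x 0 j - y 0 j.
    by rewrite /d minEle; case: ifP; [left|right].
  + by apply: (step y' i) => //; [rewrite lt_eqF|rewrite y'i dE; lra].
  + by apply: (step y' j) => //; [rewrite gt_eqF|rewrite y'j dE; lra].
- have [/existsP[i xyi]|/existsPn yx] := boolP
      [exists i, x 0 i != y 0 i]; last first.
    rewrite (_ : x = y)//; apply/rowP => i; apply/eqP; rewrite -[_ == _]negbK.
    exact: yx.
  have xlt : x 0 i < y 0 i by rewrite lt_neqAle xyi leNgt xley.
  have yi0 : 0 < y 0 i by apply: le_lt_trans xlt.
  (* [y'] is a convex combination of [y] and of [y] with the sign of its [i]-th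
     coordinate changed. *)
  pose t := (y 0 i - x 0 i) / (2 * y 0 i).
  pose y' := (1 - t) *: y + t *: \row_j ((-1) ^+ (j == i) * y 0 j).
  (* The value of [t] solves [(1 - 2 * t) * y 0 i = x 0 i]. *)
  have y'i : y' 0 i = x 0 i.
    by rewrite !mxE eqxx expr1 /t; field; rewrite gt_eqF.
  have y'l l : l != i -> y' 0 l = y 0 l.
    by move=> /negPf li; rewrite !mxE li expr0; ring.
  apply: (step y' i) => //.
  + apply: gauge_convex => //; last by rewrite (Phisign (fun j => j == i)).
    apply/andP; split; first by rewrite divr_ge0 ?subr_ge0 ?ltW ?mulr_gt0.
    rewrite ler_pdivrMr ?mulr_gt0//; have := x0 i; lra.
  + move=> l xyl; apply: y'l; apply: contraNneq xyi => <-; exact/eqP.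
  + move=> k _; apply: ler_sum => l _;
    have [->|li] := eqVneq l i; first by rewrite y'i.
    by rewrite y'l// leNgt xley.
Qed.

(** * From inequalities on products to inequalities on sums *)

(** Abel summation: since the partial sums of [l] are nonnegative, lowering their weight from [x m]
    to [x m.+1] only decreases them. *)
Lemma abel_sum_ge0 (R : realDomainType) (x l : nat -> R) k :
  (forall i, 0 <= x i) -> (forall i, x i.+1 <= x i) ->
  (forall m, (m <= k)%N -> 0 <= \sum_(i < m) l i) ->
  0 <= \sum_(i < k) x i * l i.
Proof.
move=> x0 xdecr l0.
suff H m : (m < k)%N -> x m * \sum_(i < m.+1) l i <= \sum_(i < m.+1) x i * l i.
  case: k l0 H => [|k] l0 H; first by rewrite big_ord0.
  by apply: le_trans (H k (ltnSn _)); rewrite mulr_ge0// l0.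
elim: m => [|m IHm] mk; first by rewrite !big_ord1.
rewrite big_ord_recr [leRHS]big_ord_recr/= mulrDr lerD2r.
apply: le_trans (IHm (ltnW mk)).
by rewrite ler_wpM2r// l0// ltnW.
Qed.

(** As [ln t <= t - 1], each [y i - x i] is at least [x i * ln (y i / x i)]. The partial sums of
    these logarithms are logarithms of ratios of the products, hence nonnegative, and Abel summation
    applies. *)
Lemma weak_majorization_of_log (R : realType) (x y : nat -> R) :
  (forall i, 0 <= x i) -> (forall i, x i.+1 <= x i) -> (forall i, 0 <= y i) ->
  (forall k, \prod_(i < k) x i <= \prod_(i < k) y i) ->
  forall k, \sum_(i < k) x i <= \sum_(i < k) y i.
Proof.
move=> x0 xdecr y0 xy; elim=> [|k IHk]; first by rewrite !big_ord0.
(* A zero [x k] adds nothing on the left; otherwise every [x i] and [y i] with [i <= k] is positive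
   and has a genuine logarithm. *)
have [xk0|xkN0] := eqVneq (x k) 0.
  by rewrite !big_ord_recr/= xk0 lerD.
have xpos i : (i <= k)%N -> 0 < x i.
  move=> ik; apply: (@lt_le_trans _ _ (x k)).
    by rewrite lt_neqAle eq_sym xkN0/=.
  apply: (@homo_leq _ x (fun a b => b <= a)) ik => [a|b a c ba cb|]//.
  exact: le_trans cb ba.
have ypos i : (i <= k)%N -> 0 < y i.
  move=> ik; rewrite lt_neqAle eq_sym y0 andbT; apply/negP => /eqP yi0.
  have := xy k.+1;
  rewrite [leRHS](bigD1 (Ordinal (ik : (i < k.+1)%N)))//= yi0 mul0r.
  by rewrite leNgt prodr_gt0// => j _; apply: xpos; rewrite -ltnS.
have lnE m : (m <= k.+1)%N -> \sum_(i < m) ln (y i / x i) =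
    ln (\prod_(i < m) y i / \prod_(i < m) x i).
  elim: m => [|m IHm] mk; first by rewrite !big_ord0 invr1 mulr1 ln1.
  have py : 0 < \prod_(i < m) y i.
    by apply: prodr_gt0 => i _; apply/ypos/ltnW/(leq_trans (ltn_ord i)).
  have px : 0 < \prod_(i < m) x i.
    by apply: prodr_gt0 => i _; apply/xpos/ltnW/(leq_trans (ltn_ord i)).
  rewrite !big_ord_recr/= IHm ?(ltnW mk)// -lnM ?posrE ?divr_gt0 ?xpos ?ypos//.
  by rewrite invfM mulrACA.
rewrite -subr_ge0 -sumrB.
apply: (@le_trans _ _ (\sum_(i < k.+1) x i * ln (y i / x i))).
  apply: (@abel_sum_ge0 _ x (fun i => ln (y i / x i))) => // m mk; rewrite lnE//.
  apply: ln_ge0.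
  rewrite ler_pdivlMr ?mul1r//; apply: prodr_gt0 => i _; apply: xpos.
  by rewrite -ltnS (leq_trans (ltn_ord i)).
apply: ler_sum => i _;
have xi := xpos i (ltn_ord i); have yi := ypos i (ltn_ord i).
have -> : y i - x i = x i * (y i / x i - 1) by field; rewrite gt_eqF.
rewrite ler_pM2l// lerBrDl -[leRHS]lnK ?posrE ?divr_gt0//.
exact: expR_ge1Dx.
Qed.

(** * Determinants of diagonal forms *)

(** Multilinearity in the rows: row [i] of the product combines the rows of [W], and [f i] tells
    which one is picked. *)
Lemma det_mulmx_rowsub (R : comPzRingType) k n (M : 'M[R]_(k, n))
    (W : 'M[R]_(n, k)) :
  \det (M *m W) =
    \sum_(f : {ffun 'I_k -> 'I_n}) (\prod_i M i (f i)) * \det (mxsub f id W).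
Proof.
transitivity (\sum_(f : {ffun 'I_k -> 'I_n}) \sum_(s : 'S_k)
    (-1) ^+ s * \prod_i (M i (f i) * W (f i) (s i))).
  rewrite exchange_big; apply: eq_bigr => /= s _; rewrite -big_distrr /=.
  congr (_ * _); rewrite -(bigA_distr_bigA (fun i j => M i j * W j (s i))) /=.
  by apply: eq_bigr => i _; rewrite mxE.
apply: eq_bigr => f _; rewrite big_distrr/=; apply: eq_bigr => s _.
rewrite mulrCA big_split/=; congr (_ * (_ * _)).
by apply: eq_bigr => i _; rewrite mxE.
Qed.

(* The Cauchy-Binet formula, summed over all maps [f] instead of over the
   subsets of size [k]: hence the factor [k`!]. *)
Lemma det_form_diag (C : numClosedFieldType) k n (W : 'M[C]_(n, k)) (d : 'rV_n) :
  k`!%:R * \det (W^t* *m diag_mx d *m W) =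
    \sum_(f : {ffun 'I_k -> 'I_n})
      (\prod_i d 0 (f i)) * `|\det (mxsub f id W)| ^+ 2.
Proof.
rewrite det_mulmx_rowsub; set g := BIG_F.
(* Composing [f] with [s] preserves the sum; summing over all [s] then produces the Leibniz
   expansion of the conjugate minor. *)
have gE (s : 'S_k) : \sum_f g f =
    \sum_(f : {ffun 'I_k -> 'I_n}) g [ffun i => f (s i)].
  rewrite (reindex (fun f : {ffun 'I_k -> 'I_n} => [ffun i => f (s i)]))//.
  exists (fun f : {ffun 'I_k -> 'I_n} => [ffun i => f (s^-1%g i)]) => f _;
    by apply/ffunP => i; rewrite !ffunE ?permK ?permKV.
have -> : k`!%:R * \sum_f g f = \sum_(s : 'S_k) \sum_f g f.
  by rewrite sumr_const card_Sn mulr_natl.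
rewrite (eq_bigr _ (fun s _ => gE s)) exchange_big; apply: eq_bigr => f _ /=.
rewrite normCKC -det_map_mx -det_tr [X in _ = _ * (X * _)]/determinant.
rewrite mulr_suml mulr_sumr.
apply: eq_bigr => s _; rewrite /g.
have -> : mxsub [ffun i => f (s i)] id W = row_perm s (mxsub f id W).
  by apply/matrixP => i j; rewrite !mxE ffunE.
rewrite row_permE det_mulmx det_perm mulrA [LHS]mulrA; congr (_ * _).
rewrite mulrC mulrCA; congr (_ * _).
rewrite [X in _ = X * _](reindex_perm s) -big_split; apply: eq_bigr => i _ /=.
by rewrite mul_mx_diag !mxE !ffunE mulrC.
Qed.

(** In [det_form_diag], a non-injective map repeats a row and contributes zero, while the weights
    are squared moduli; only products along injective maps need comparing. *)
Lemma ler_det_form_diag (C : numClosedFieldType) k n (W : 'M[C]_(n, k))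
    (d e : 'rV_n) (a b : C) :
  (forall f : 'I_k -> 'I_n, injective f ->
    a * \prod_i d 0 (f i) <= b * \prod_i e 0 (f i)) ->
  a * \det (W^t* *m diag_mx d *m W) <= b * \det (W^t* *m diag_mx e *m W).
Proof.
move=> de; have k0 : 0 < k`!%:R :> C by rewrite ltr0n fact_gt0.
rewrite -(ler_pM2l k0) !(mulrCA k`!%:R) !det_form_diag !mulr_sumr.
apply: ler_sum => f _; rewrite mulrA [leRHS]mulrA.
have [/injectiveP f_inj|/injectivePn[i [j ij fij]]] := boolP (injectiveb f).
  exact: ler_wpM2r (exprn_ge0 2 (normr_ge0 _)) _ _ (de f f_inj).
rewrite (determinant_alternate ij) ?normr0 ?expr0n ?mulr0//.
by move=> l; rewrite !mxE fij.
Qed.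

(** * Extremal products of entries *)

(** Outside the common factors, the two sets have the same size, and the power of [c] with that
    exponent separates the products. *)
Lemma ler_prod_exchange (R : realDomainType) (I : finType) (S T : {set I})
    (d : I -> R) (c : R) :
  #|S| = #|T| -> (forall i, 0 <= d i) ->
  {in S :\: T, forall i, d i <= c} -> {in T :\: S, forall i, c <= d i} ->
  \prod_(i in S) d i <= \prod_(i in T) d i.
Proof.
move=> ST d0 dc cd.
rewrite (big_setID T)/= [leRHS](big_setID S)/= finset.setIC.
apply: ler_wpM2l; first exact: prodr_ge0.
have cST : #|S :\: T| = #|T :\: S|.
  by apply/eqP; rewrite -(eqn_add2l #|S :&: T|) cardsID finset.setIC cardsID ST.
have [ST0|[i iST]] := set_0Vmem (S :\: T).
  move: cST; rewrite ST0 cards0 => /esym/eqP; rewrite cards_eq0 => /eqP->.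
  by rewrite !big_set0.
have c0 : 0 <= c by apply: (le_trans (d0 i)); exact: dc.
apply: (@le_trans _ _ (c ^+ #|S :\: T|)).
  by rewrite -prodr_const; apply: ler_prod => j jST; rewrite d0 dc.
by rewrite cST -prodr_const; apply: ler_prod => j jTS; rewrite c0 cd.
Qed.

Section ProdFirst.
Variables (R : realDomainType) (n k : nat) (kn : (k <= n)%N) (d : 'I_n -> R).
Variable f : 'I_k -> 'I_n.
Hypotheses (f_inj : injective f) (d0 : forall i, 0 <= d i).

Let w_inj : injective (widen_ord kn).
Proof. by move=> i j /(congr1 val)/= /val_inj. Qed.

(** The image of [f] is exchanged for the first [k] indices, the last of which supplies the
    threshold; [k = 0] has none and is treated apart. *)
Lemma ler_prod_first :
  (forall i j : 'I_n, (i <= j)%N -> d j <= d i) ->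
  \prod_i d (f i) <= \prod_i d (widen_ord kn i).
Proof.
case: k kn f f_inj w_inj => [|m] mn g g_inj v_inj ddecr; first by rewrite !big_ord0.
rewrite -(big_imset d (in2W g_inj)) -(big_imset d (in2W v_inj))/=.
apply: (@ler_prod_exchange _ _ _ _ _ (d (widen_ord mn ord_max))) => //.
- by rewrite !card_imset.
- move=> i /setDP[_ iN]; apply: ddecr; rewrite /= leqNgt; apply: contra iN => im.
  by apply/imsetP; exists (Ordinal (leqW im)) => //; apply: val_inj.
- by move=> _ /setDP[/imsetP[i _ ->] _]; apply: ddecr; rewrite /= -ltnS.
Qed.

Lemma ger_prod_first :
  (forall i j : 'I_n, (i <= j)%N -> d i <= d j) ->
  \prod_i d (widen_ord kn i) <= \prod_i d (f i).
Proof.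
case: k kn f f_inj w_inj => [|m] mn g g_inj v_inj dincr; first by rewrite !big_ord0.
rewrite -(big_imset d (in2W g_inj)) -(big_imset d (in2W v_inj))/=.
apply: (@ler_prod_exchange _ _ _ _ _ (d (widen_ord mn ord_max))) => //.
- by rewrite !card_imset.
- by move=> _ /setDP[/imsetP[i _ ->] _]; apply: dincr; rewrite /= -ltnS.
- move=> i /setDP[_ iN]; apply: dincr; rewrite /= leqNgt; apply: contra iN => im.
  by apply/imsetP; exists (Ordinal (leqW im)) => //; apply: val_inj.
Qed.

End ProdFirst.

(** * Unitary diagonalization and functional calculus *)

(** Neither [P] nor the order of [d] is prescribed, so any diagonalization can be compared with the
    one chosen by [spectralmx]. *)
Definition udiag (R : realType) n (G : 'M[R[i]]_n) (d : 'rV[R]_n) : Prop :=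
  exists2 P : 'M[R[i]]_n, P \is unitarymx &
    G = invmx P *m diag_mx (map_mx (real_complex R) d) *m P.

Lemma row_perm_unitary (C : numClosedFieldType) n (s : 'S_n) (P : 'M[C]_n) :
  P \is unitarymx -> row_perm s P \is unitarymx.
Proof.
move=> Pu; rewrite row_permE mul_unitarymx//; apply/unitarymxP.
by rewrite tr_perm_mx map_perm_mx -perm_mxM mulgV perm_mx1.
Qed.

Lemma unitary_diag_perm (C : numClosedFieldType) n (s : 'S_n) (P : 'M[C]_n)
    (d : 'rV_n) :
  P \is unitarymx ->
  invmx P *m diag_mx d *m P =
  invmx (row_perm s P) *m diag_mx (col_perm s d) *m row_perm s P.
Proof.
move=> Pu; rewrite !invmx_unitary ?row_perm_unitary//.
rewrite row_permE trmx_mul map_mxM tr_perm_mx map_perm_mx !mulmxA.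
congr (_ *m _); rewrite -!mulmxA; congr (_ *m _).
rewrite mul_diag_mx -row_permE; apply/matrixP => i j.
by rewrite !mxE permKV mulr_natr.
Qed.

(** The common characteristic polynomial determines its linear factors with multiplicity. *)
Lemma invmx_diag_perm_eq (F : fieldType) n (P Q : 'M[F]_n) (d e : 'rV[F]_n) :
  P \in unitmx -> Q \in unitmx ->
  invmx P *m diag_mx d *m P = invmx Q *m diag_mx e *m Q ->
  perm_eq [seq d 0 k | k : 'I_n] [seq e 0 k | k : 'I_n].
Proof.
move=> Pu Qu PQ; apply: prod_XsubC_eq; rewrite !big_image.
have charE (M : 'M[F]_n) (c : 'rV[F]_n) : M \in unitmx ->
    char_poly (invmx M *m diag_mx c *m M) = \prod_k ('X - (c 0 k)%:P).
  move=> Mu; rewrite /char_poly /char_poly_mx.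
  have Pu' : map_mx polyC M \in unitmx by rewrite map_unitmx.
  rewrite !map_mxM map_invmx.
  rewrite -[X in X - _](mulKmx Pu') scalar_mxC mulmxA -mulmxBl -mulmxBr.
  rewrite !det_mulmx mulrC mulrA -det_mulmx mulmxV// det1 mul1r.
  rewrite (_ : _ - _ = diag_mx (\row_k ('X - (c 0 k)%:P))) ?det_diag.
    by apply: eq_bigr => k _; rewrite !mxE.
  apply/matrixP => i j; rewrite !mxE.
  by case: eqP => [->|]; rewrite ?mulr1n ?mulr0n ?subr0.
by rewrite -(charE P d Pu) -(charE Q e Qu); congr char_poly.
Qed.

Lemma perm_eq_row (R : eqType) n (x0 : R) (s : seq R) (d : 'rV[R]_n) :
  perm_eq s [seq d 0 k | k : 'I_n] ->
  exists t : 'S_n, \row_j nth x0 s j = col_perm t d.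
Proof.
move=> sd; have /eqP sz : size s == n.
  by rewrite (perm_size sd) size_map size_enum_ord.
have /tuple_permP[t sE] : perm_eq s [tuple d 0 k | k < n].
  by rewrite (perm_trans sd)// perm_refl.
exists t; apply/rowP => j; rewrite !mxE sE.
rewrite -(tnth_nth x0 [tuple tnth [tuple d 0 k | k < n] (t i) | i < n]).
by rewrite !tnth_mktuple.
Qed.

Lemma udiag_col_perm (R : realType) n (G : 'M[R[i]]_n) d (s : 'S_n) :
  udiag G d -> udiag G (col_perm s d).
Proof.
move=> [P Pu ->]; exists (row_perm s P); first exact: row_perm_unitary.
rewrite map_col_perm; exact: unitary_diag_perm.
Qed.

Lemma udiag_spectral (R : realType) n (G : 'M[R[i]]_n) d :
  udiag G d -> exists s : 'S_n,
    G = invmx (spectralmx G)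
          *m diag_mx (map_mx (real_complex R) (col_perm s d)) *m spectralmx G /\
    spectral_diag G = map_mx (real_complex R) (col_perm s d).
Proof.
move=> [P Pu GE].
have /orthomx_spectralP GS : G \is normalmx.
  by apply/orthomx_spectral_subproof; exists (P, map_mx (real_complex R) d).
have [|s dE] := @perm_eq_row _ n 0 [seq spectral_diag G 0 k | k : 'I_n]
    (map_mx (real_complex R) d).
  apply: (invmx_diag_perm_eq (spectral_unit G) (unitarymx_unit Pu)).
  exact: etrans (esym GS) GE.
have {}dE : spectral_diag G = map_mx (real_complex R) (col_perm s d).
  rewrite map_col_perm -dE; apply/rowP => j; rewrite mxE (nth_map j) ?size_enum_ord//.
  by rewrite nth_ord_enum.
by exists s; rewrite -dE; split; first exact: GS.
Qed.

(** The spectral decomposition may list the eigenvalues in another order [s]; [f] acts entrywise, so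
    it commutes with [s], which is then undone. *)
Lemma udiag_herm_fun (R : realType) n (f : R -> R) (G : 'M[R[i]]_n) d :
  udiag G d -> udiag (herm_fun f G) (map_mx f d).
Proof.
move=> Gd; have [s [GE dE]] := udiag_spectral Gd.
have -> : map_mx f d = col_perm s^-1 (map_mx f (col_perm s d)).
  by apply/rowP => j; rewrite !mxE permKV.
apply: udiag_col_perm; exists (spectralmx G); first exact: spectral_unitarymx.
rewrite /herm_fun; set e := map_mx _ (spectral_diag G).
suff -> : e = map_mx (real_complex R) (map_mx f (col_perm s d)) by exact: erefl.
by rewrite /e dE; apply/rowP => j; rewrite !mxE.
Qed.

Lemma unitary_diag_sqr (C : numClosedFieldType) n (P : 'M[C]_n) (d : 'rV_n) :
  P \is unitarymx -> (forall i, d 0 i \is Num.real) ->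
  let H := invmx P *m diag_mx d *m P in
  H^t* *m H = invmx P *m diag_mx (map_mx (fun x => x ^+ 2) d) *m P.
Proof.
move=> Pu dreal H; have Pu' := unitarymx_unit Pu.
have -> : H^t* = H.
  rewrite /H invmx_unitary// !trmx_mul !map_mxM trmxCK tr_diag_mx map_diag_mx mulmxA.
  congr (_ *m diag_mx _ *m _); apply/rowP => i; rewrite mxE; exact: conj_Creal.
rewrite /H !mulmxA mulmxK// -(mulmxA _ (diag_mx d) (diag_mx d)) mulmx_diag.
by congr (_ *m diag_mx _ *m _); apply/rowP => i; rewrite !mxE expr2.
Qed.

Lemma udiag_sqr (R : realType) n (H : 'M[R[i]]_n) d :
  udiag H d -> udiag (H^t* *m H) (map_mx (fun x => x ^+ 2) d).
Proof.
move=> [P Pu ->]; exists P => //.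
have -> : map_mx (real_complex R) (map_mx (fun x => x ^+ 2) d) =
    map_mx (fun x => x ^+ 2) (map_mx (real_complex R) d).
  by apply/rowP => i; rewrite !mxE rmorphXn.
by apply: unitary_diag_sqr => // i; rewrite mxE complex_real.
Qed.

Lemma udiag_gram (R : realType) m n (X : 'M[R[i]]_(m, n)) :
  exists2 d, udiag (X^t* *m X) d & forall i, 0 <= d 0 i.
Proof.
set G := _ *m X.
have GT : G^t* = G by rewrite /G trmx_mul map_mxM trmxCK.
have /orthomx_spectralP GS : G \is normalmx by apply/normalmxP; rewrite GT.
have Pu := spectral_unitarymx G; set P := spectralmx G in GS Pu.
have d0 i : 0 <= spectral_diag G 0 i.
  (* A Gram matrix again, so its diagonal entries are sums of squared moduli. *)
  have DE : diag_mx (spectral_diag G) = (X *m P^t*)^t* *m (X *m P^t*).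
    rewrite trmx_mul map_mxM trmxCK !mulmxA -(mulmxA _ _ X) -/G.
    rewrite [X in _ = _ *m X *m _]GS.
    rewrite -invmx_unitary// !mulmxA mulmxV ?unitarymx_unit// mul1mx.
    by rewrite mulmxK ?unitarymx_unit.
  have -> : spectral_diag G 0 i = diag_mx (spectral_diag G) i i
    by rewrite mxE eqxx mulr1n.
  rewrite DE mxE; apply: sumr_ge0 => j _; rewrite 2!mxE mulrC.
  exact: mul_conjC_ge0.
have spE : spectral_diag G =
    map_mx (real_complex R) (map_mx (@complex.Re R) (spectral_diag G)).
  by apply/rowP => i; rewrite !mxE RRe_real// ger0_real.
exists (map_mx (@complex.Re R) (spectral_diag G)).
  by exists P; [exact: Pu|rewrite -spE; exact: GS].
by move=> i; rewrite mxE; have := d0 i; rewrite lecE => /andP[].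
Qed.

(** * Determinant bounds from extremal products *)

Section ProductBound.
Variables (C : numClosedFieldType) (n k : nat).

Lemma unitary_form (P : 'M[C]_n) (d : 'rV_n) (W : 'M[C]_(n, k)) :
  P \is unitarymx ->
  W^t* *m (invmx P *m diag_mx d *m P) *m W =
    (P *m W)^t* *m diag_mx d *m (P *m W).
Proof. by move=> Pu; rewrite invmx_unitary// trmx_mul map_mxM !mulmxA. Qed.

(** Makes the Gram matrix of [W] comparable, through [ler_det_form_diag], with the form in
    [unitary_form]. *)
Lemma unitary_form1 (P : 'M[C]_n) (W : 'M[C]_(n, k)) :
  P \is unitarymx -> W^t* *m W = (P *m W)^t* *m diag_mx (const_mx 1) *m (P *m W).
Proof.
move=> Pu; rewrite -unitary_form// diag_const_mx mulmx1 mulVmx ?mulmx1//.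
exact: unitarymx_unit.
Qed.

Lemma det_form_le (P : 'M[C]_n) (d : 'rV_n) (W : 'M[C]_(n, k)) (M : C) :
  P \is unitarymx ->
  (forall f : 'I_k -> 'I_n, injective f -> \prod_i d 0 (f i) <= M) ->
  \det (W^t* *m (invmx P *m diag_mx d *m P) *m W) <= M * \det (W^t* *m W).
Proof.
move=> Pu dM; rewrite -[leLHS]mul1r unitary_form// (unitary_form1 _ Pu).
apply: ler_det_form_diag => f f_inj; rewrite mul1r.
by under [X in _ * X]eq_bigr do rewrite mxE; rewrite big1_eq mulr1 dM.
Qed.

Lemma det_form_ge (P : 'M[C]_n) (d : 'rV_n) (W : 'M[C]_(n, k)) (m : C) :
  P \is unitarymx ->
  (forall f : 'I_k -> 'I_n, injective f -> m <= \prod_i d 0 (f i)) ->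
  m * \det (W^t* *m W) <= \det (W^t* *m (invmx P *m diag_mx d *m P) *m W).
Proof.
move=> Pu dm; rewrite -[leRHS]mul1r unitary_form// (unitary_form1 _ Pu).
apply: ler_det_form_diag => f f_inj; rewrite mul1r.
by under [X in _ * X]eq_bigr do rewrite mxE; rewrite big1_eq mulr1 dm.
Qed.

Lemma rowsub_unitary (P : 'M[C]_n) (w : 'I_k -> 'I_n) :
  P \is unitarymx -> injective w -> mxsub w id P \is unitarymx.
Proof.
move=> Pu w_inj; apply/unitarymxP; rewrite trmx_mxsub map_mxsub -mxsub_mul.
rewrite (unitarymxP Pu); apply/matrixP => i j; rewrite !mxE.
by rewrite (inj_eq w_inj).
Qed.

Lemma rowsub_diag_form (P : 'M[C]_n) (d : 'rV_n) (w : 'I_k -> 'I_n) :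
  P \is unitarymx -> injective w ->
  \det (mxsub w id P *m (invmx P *m diag_mx d *m P) *m (mxsub w id P)^t*) =
    \prod_i d 0 (w i).
Proof.
move=> Pu w_inj; rewrite trmx_mxsub map_mxsub mul_rowsub_mx -mxsub_mul.
rewrite !mulmxA mulmxV ?unitarymx_unit// mul1mx -mulmxA (unitarymxP Pu) mulmx1.
rewrite (_ : mxsub _ _ _ = diag_mx (\row_i d 0 (w i))) ?det_diag.
  by apply: eq_bigr => i _; rewrite mxE.
by apply/matrixP => i j; rewrite !mxE (inj_eq w_inj).
Qed.

(* With [V] the eigenvectors of [A^* A] selected by [w] and [W = B^-1 V], the
   matrix [V^* A^* A V] is also [W^* (A B)^* (A B) W]. *)
Lemma prod_gram_mul (A B P Q S : 'M[C]_n) (a g b : 'rV_n) (w : 'I_k -> 'I_n)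
    (M m : C) :
  B \in unitmx -> P \is unitarymx -> Q \is unitarymx -> S \is unitarymx ->
  A^t* *m A = invmx P *m diag_mx a *m P ->
  (A *m B)^t* *m (A *m B) = invmx Q *m diag_mx g *m Q ->
  B^t* *m B = invmx S *m diag_mx b *m S ->
  injective w -> 0 <= m -> 0 <= M ->
  (forall f : 'I_k -> 'I_n, injective f -> \prod_i g 0 (f i) <= M) ->
  (forall f : 'I_k -> 'I_n, injective f -> m <= \prod_i b 0 (f i)) ->
  m * \prod_i a 0 (w i) <= M.
Proof.
move=> Bu Pu Qu Su AP ABQ BS w_inj m0 M0 gM bm.
set V := (mxsub w id P)^t*.
have [W BW] : exists W, B *m W = V by exists (invmx B *m V); rewrite mulKVmx.
have VtV : V^t* *m V = 1%:M.
  by rewrite trmxCK; apply/unitarymxP; apply: rowsub_unitary.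
have aE : \prod_i a 0 (w i) = \det (W^t* *m ((A *m B)^t* *m (A *m B)) *m W).
  rewrite -(rowsub_diag_form _ Pu w_inj) -AP -/V.
  have -> : mxsub w id P = V^t* by rewrite trmxCK.
  rewrite -BW.
  by rewrite !trmx_mul !map_mxM !mulmxA.
(* As [B *m W = V] has orthonormal columns, this bound reads [m * \det (W^t* *m W) <= 1]. *)
have := det_form_ge W Su bm; rewrite -BS.
have -> : W^t* *m (B^t* *m B) *m W = 1%:M.
  by rewrite -VtV -BW trmx_mul map_mxM !mulmxA.
rewrite det1 => mW.
(* The product of the selected [a] is at most [M * \det (W^t* *m W)]; multiplying by [m] eliminates
   the determinant. *)
have WM := det_form_le W Qu gM; rewrite -ABQ -aE in WM.
apply: le_trans (ler_wpM2l m0 WM) _; rewrite mulrCA.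
by rewrite -[leRHS]mulr1 ler_wpM2l.
Qed.

End ProductBound.

(** * Products of powers, and majorization for rows *)

Lemma prod_powR (R : realType) (I : finType) (F : I -> R) p :
  (forall i, 0 <= F i) -> \prod_i F i `^ p = (\prod_i F i) `^ p.
Proof.
move=> F0; have [_ ->//] : 0 <= \prod_i F i /\ \prod_i F i `^ p = (\prod_i F i) `^ p.
elim/big_rec2: _ => [|i x y _ [x0 ->]]; first by rewrite powR1.
by rewrite mulr_ge0// powRM.
Qed.

Lemma weak_majorization_of_log_row (R : realType) m (x y : 'rV[R]_m) :
  (forall i, 0 <= x 0 i) -> (forall i, 0 <= y 0 i) ->
  (forall i j : 'I_m, (i <= j)%N -> x 0 j <= x 0 i) ->
  (forall k (km : (k <= m)%N),
    \prod_(i < k) x 0 (widen_ord km i) <= \prod_(i < k) y 0 (widen_ord km i)) ->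
  forall k, (k <= m)%N ->
    \sum_(j : 'I_m | (j < k)%N) x 0 j <= \sum_(j : 'I_m | (j < k)%N) y 0 j.
Proof.
move=> x0 y0 xdecr xy k km.
pose ext (z : 'rV[R]_m) i := oapp (z 0) 0 (insub i : option 'I_m).
have extE z l (lm : (l <= m)%N) (i : 'I_l) : ext z i = z 0 (widen_ord lm i).
  rewrite /ext insubT /=; first exact: leq_trans (ltn_ord i) lm.
  by move=> im; congr (z 0 _); apply: val_inj.
have ext0 z i : (m <= i)%N -> ext z i = 0.
  by move=> mi; rewrite /ext insubN// -leqNgt.
have ext_ge0 (z : 'rV_m) : (forall i, 0 <= z 0 i) -> forall i, 0 <= ext z i.
  by move=> z0 i; rewrite /ext; case: insub.
rewrite !(big_ord_narrow km).
rewrite -(eq_bigr _ (fun i _ => extE x k km i)).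
rewrite -(eq_bigr _ (fun i _ => extE y k km i)).
apply: weak_majorization_of_log; [exact: ext_ge0| |exact: ext_ge0|].
- move=> i; have [im|mi] := ltnP i.+1 m; last by rewrite (ext0 _ i.+1)// ext_ge0.
  have := xdecr (Ordinal (ltnW im)) (Ordinal im) (leqnSn _).
  rewrite /ext !insubT ?(ltnW im)// => im'.
  by rewrite (bool_irrelevance im' (ltnW im)).
- move=> l; have [lm|ml] := leqP l m.
    under eq_bigr do rewrite extE; under [leRHS]eq_bigr do rewrite extE.
    exact: xy.
  (* Beyond [m], the left product contains the zero that extends [x] at index [m]. *)
  rewrite (bigD1 (Ordinal ml))//= ext0// mul0r.
  by apply: prodr_ge0 => i _; exact: ext_ge0.
Qed.

Lemma perm_eq_col_perm (R : eqType) n (s : 'S_n) (d : 'rV[R]_n) :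
  perm_eq [seq col_perm s d 0 k | k : 'I_n] [seq d 0 k | k : 'I_n].
Proof.
apply/(@tuple_permP _ n _ [tuple d 0 k | k < n]); exists s.
by apply: eq_map => k; rewrite mxE tnth_mktuple.
Qed.

Lemma col_perm_sorted (R : realDomainType) n (d : 'rV[R]_n) :
  exists s : 'S_n,
    forall i j : 'I_n, (i <= j)%N -> col_perm s d 0 j <= col_perm s d 0 i.
Proof.
pose l := sort >=%R [seq d 0 k | k : 'I_n].
have [s sE] : exists s : 'S_n, \row_j nth 0 l j = col_perm s d.
  by apply: perm_eq_row; rewrite perm_sort.
exists s => i j ij; rewrite -sE !mxE.
have sz : size l = n by rewrite size_sort size_map size_enum_ord.
apply: (@sorted_leq_nth _ >=%R) => //; rewrite ?inE ?sz//.
- by move=> a b c ba cb; apply: le_trans cb ba.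
- by move=> a; exact: lexx.
- by apply: sort_sorted => a b; exact: le_total.
Qed.

(** * Singular values up to order *)

Section SingularValues.
Variables (R : realType) (n : nat).
Implicit Types (X : 'M[R[i]]_n) (d : 'rV[R]_n).

(* The entries of [d] are the singular values of [X], in any order. *)
Definition is_sv X d :=
  udiag (X^t* *m X) (map_mx (fun t => t ^+ 2) d) /\ forall i, 0 <= d 0 i.

Lemma is_sv_col_perm X d (s : 'S_n) : is_sv X d -> is_sv X (col_perm s d).
Proof.
case=> /(udiag_col_perm s); rewrite -map_col_perm => ? d0.
by split=> // i; rewrite mxE.
Qed.

Lemma exists_is_sv X : exists2 d, is_sv X d &
  forall i j : 'I_n, (i <= j)%N -> d 0 j <= d 0 i.
Proof.
have [d Xd d0] := udiag_gram X.
have Xsd : is_sv X (map_mx Num.sqrt d).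
  split; last by move=> i; rewrite mxE sqrtr_ge0.
  rewrite (_ : map_mx _ _ = d)//.
  by apply/rowP => i; rewrite !mxE sqr_sqrtr.
have [s sdecr] := col_perm_sorted (map_mx Num.sqrt d).
by exists (col_perm s (map_mx Num.sqrt d)); [exact: is_sv_col_perm|exact: sdecr].
Qed.

(** Meant for [B]: the first [k] entries then have the smallest product among all choices of [k]
    entries. *)
Lemma exists_is_sv_nondecreasing X : exists2 d, is_sv X d &
  forall i j : 'I_n, (i <= j)%N -> d 0 i <= d 0 j.
Proof.
have [d Xd ddecr] := exists_is_sv X.
exists (col_perm (perm rev_ord_inj) d); first exact: is_sv_col_perm.
by move=> i j ij; rewrite !mxE !permE ddecr//= leq_sub2l.
Qed.

Lemma udiag_mxabs X d : is_sv X d -> udiag (mxabs X) d.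
Proof.
case=> /(udiag_herm_fun Num.sqrt); rewrite -/(mxabs X) => Xd d0.
suff -> : d = map_mx Num.sqrt (map_mx (fun t => t ^+ 2) d) by [].
by apply/rowP => i; rewrite !mxE sqrtr_sqr ger0_norm.
Qed.

Lemma singular_values_perm X d :
  is_sv X d -> exists s : 'S_n, singular_values X = col_perm s d.
Proof.
move=> /udiag_mxabs/udiag_spectral[s [_ XE]].
apply: perm_eq_row; rewrite perm_sort XE.
apply: perm_trans (perm_eq_col_perm s d).
rewrite [X in perm_eq X _](_ : _ = [seq col_perm s d 0 k | k : 'I_n])//.
by apply: eq_map => k; rewrite mxE.
Qed.

(** The power is Hermitian and its eigenvalues are nonnegative, so they are also its singular
    values. *)
Lemma is_sv_mxabs_pow X d p :
  is_sv X d -> is_sv (mxabs_pow X p) (map_mx (fun t => t `^ p) d).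
Proof.
move=> Xd; split; last by move=> i; rewrite mxE powR_ge0.
by apply/udiag_sqr/udiag_herm_fun/udiag_mxabs.
Qed.

Lemma is_sv_unit_gt0 X d i : X \in unitmx -> is_sv X d -> 0 < d 0 i.
Proof.
move=> Xu [[P Pu XE] d0]; rewrite lt_neqAle d0 andbT eq_sym.
apply/negP => /eqP di0.
have : X^t* *m X \in unitmx.
  by rewrite unitmx_mul Xu map_unitmx unitmx_tr Xu.
rewrite XE unitmxE !det_mulmx det_diag (bigD1 i)//= !mxE di0 expr0n/=.
by rewrite !(mul0r, mulr0) unitr0.
Qed.

End SingularValues.

Lemma gauge_mxabs_pow (R : realType) n (Phi : 'rV[R]_n.+1 -> R)
    (X : 'M[R[i]]_n.+1) d p :
  symmetric_gauge Phi -> is_sv X d ->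
  Phi (singular_values (mxabs_pow X p)) = Phi (map_mx (fun t => t `^ p) d).
Proof.
move=> [_ Phiperm _ _] /(is_sv_mxabs_pow p)/singular_values_perm[s ->].
exact: Phiperm.
Qed.

(** * Horn's inequality, Young's inequality and the conclusion *)

(** Squared, this is [prod_gram_mul] with [w] the inclusion of the first [k] indices; the orders of
    [g] and [b] make their products over these indices extremal. *)
Lemma prod_sv_mul (R : realType) n k (kn : (k <= n)%N) (A B : 'M[R[i]]_n)
    (a g b : 'rV[R]_n) :
  B \in unitmx -> is_sv A a -> is_sv (A *m B) g -> is_sv B b ->
  (forall i j : 'I_n, (i <= j)%N -> g 0 j <= g 0 i) ->
  (forall i j : 'I_n, (i <= j)%N -> b 0 i <= b 0 j) ->
  (\prod_(i < k) b 0 (widen_ord kn i)) * \prod_(i < k) a 0 (widen_ord kn i)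
    <= \prod_(i < k) g 0 (widen_ord kn i).
Proof.
move=> Bu [[P Pu AP] a0] [[Q Qu ABQ] g0] [[S Su BS] b0] gdecr bincr.
rewrite -(@ler_pXn2r _ 2) ?nnegrE ?mulr_ge0 ?prodr_ge0//.
rewrite exprMn -!prodrXl -lecR rmorphM/=.
pose sq (d : 'rV[R]_n) := map_mx (real_complex R) (map_mx (fun t => t ^+ 2) d).
have sqE (d : 'rV[R]_n) (f : 'I_k -> 'I_n) :
    (\prod_i (d 0 (f i) ^+ 2))%:C = \prod_i sq d 0 (f i).
  by rewrite rmorph_prod; apply: eq_bigr => i _; rewrite !mxE.
rewrite !sqE; apply: (prod_gram_mul Bu Pu Qu Su AP ABQ BS).
- by move=> i j /(congr1 val)/= /val_inj.
- by rewrite -sqE lecR prodr_ge0// => i _; rewrite exprn_ge0.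
- by rewrite -sqE lecR prodr_ge0// => i _; rewrite exprn_ge0.
- move=> f f_inj; rewrite -/(sq g) -!sqE lecR.
  apply: (@ler_prod_first _ _ _ kn (fun i => g 0 i ^+ 2)) => // [i|i j ij].
    exact: exprn_ge0.
  by rewrite ler_pXn2r ?nnegrE// gdecr.
- move=> f f_inj; rewrite -/(sq b) -!sqE lecR.
  apply: (@ger_prod_first _ _ _ kn (fun i => b 0 i ^+ 2)) => // [i|i j ij].
    exact: exprn_ge0.
  by rewrite ler_pXn2r ?nnegrE// bincr.
Qed.

(** Young's inequality with the positive exponents [r / p] and [- q / p], conjugate because
    [p / r - p / q = 1]. *)
Lemma young_powR (R : realType) (r p q g b : R) :
  0 < r -> 0 < p -> q < 0 -> 1 / r = 1 / p + 1 / q -> 0 <= g -> 0 <= b ->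
  g `^ p * b `^ (- p) <= p / r * g `^ r + (- p / q) * b `^ q.
Proof.
move=> r0 p0 q0 hrpq g0 b0.
have pN : p != 0 by rewrite gt_eqF.
have rN : r != 0 by rewrite gt_eqF.
have qN : q != 0 by rewrite lt_eqF.
have := @conjugate_powR R (g `^ p) (b `^ (- p)) (r / p) (- q / p).
rewrite -!powRrM !powR_ge0 divr_gt0// divr_gt0 ?oppr_gt0//.
rewrite (_ : p * (r / p) = r) 1?(_ : - p * (- q / p) = q); try by field.
move=> /(_ isT isT isT isT) H; apply: le_trans (H _) _.
  by move: hrpq; rewrite !div1r !invf_div => ->; field; rewrite pN qN.
by rewrite le_eqVlt; apply/orP; left; apply/eqP; field; rewrite pN qN rN.
Qed.

Theorem corollary2p3 (R : realType) (n : nat) (N : 'M[R[i]]_n.+1 -> R)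
    (A B : 'M[R[i]]_n.+1) (r p q : R)
    (hN : symmetric_norm N) (hB : B \in unitmx)
    (hr : 0 < r) (hp : 0 < p) (hq : q < 0)
    (hrpq : 1 / r = 1 / p + 1 / q) :
  1 / r * N (mxabs_pow (A *m B) r) >=
    1 / p * N (mxabs_pow A p) + 1 / q * N (mxabs_pow B q).
Proof.
have [_ [Phi [hPhi NE]]] := hN; have [[tri hom _] _ _ _] := hPhi.
have [a Aa adecr] := exists_is_sv A.
have [g ABg gdecr] := exists_is_sv (A *m B).
have [b Bb bincr] := exists_is_sv_nondecreasing B.
have [[[_ a0] [_ g0]] [_ b0]] := (Aa, ABg, Bb).
have NpowE X d s : is_sv X d ->
    N (mxabs_pow X s) = Phi (map_mx (fun t => t `^ s) d).
  by move=> Xd; rewrite NE; exact: gauge_mxabs_pow.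
pose x := map_mx (fun t => t `^ p) a; pose u := map_mx (fun t => t `^ r) g.
pose v := map_mx (fun t => t `^ q) b.
suff main nA nAB nB : nA = Phi x -> nAB = Phi u -> nB = Phi v ->
    1 / p * nA + 1 / q * nB <= 1 / r * nAB.
  exact: main (NpowE _ _ _ Aa) (NpowE _ _ _ ABg) (NpowE _ _ _ Bb).
move=> -> -> ->.
have pr0 : 0 <= p / r by rewrite divr_ge0// ltW.
have pq0 : 0 <= - p / q by rewrite mulNr -mulrN -invrN divr_ge0 ?oppr_ge0 ?ltW.
(* The claim times [p], with the [q] term moved to the right: both coefficients become nonnegative,
   as the triangle inequality below requires. *)
suff : Phi x <= p / r * Phi u + (- p / q) * Phi v.
  rewrite -(ler_pM2l (divr_gt0 ltr01 hp)) => H.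
  rewrite -lerBrDr; apply: le_trans H _.
  rewrite le_eqVlt; apply/orP; left; apply/eqP; field.
  by rewrite (gt_eqF hp) (gt_eqF hr) (lt_eqF hq).
apply: (@le_trans _ _ (Phi ((p / r) *: u + (- p / q) *: v))); last first.
  by apply: le_trans (tri _ _) _; rewrite !hom !ger0_norm.
(* The row [z] bounds [x] in partial products, hence in partial sums, and lies below the combination
   of [u] and [v] by Young's inequality. *)
pose z := \row_j (g 0 j `^ p * b 0 j `^ (- p)).
apply: gauge_weak_majorization => // [i|i j ij|k kn].
- by rewrite mxE powR_ge0.
- by rewrite !mxE ge0_ler_powR ?nnegrE ?adecr// ltW.
apply: (@le_trans _ _ (\sum_(j : 'I_n.+1 | (j < k)%N) z 0 j)); last first.
  by apply: ler_sum => j _; rewrite !mxE young_powR.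
apply: weak_majorization_of_log_row => // [i|i|i j ij|l ln].
- by rewrite mxE powR_ge0.
- by rewrite mxE mulr_ge0// powR_ge0.
- by rewrite !mxE ge0_ler_powR ?nnegrE ?adecr// ltW.
under eq_bigr do rewrite mxE; under [leRHS]eq_bigr do rewrite mxE.
(* With the positive product of the [b] moved to the left, this is the [p]-th power of
   [prod_sv_mul]. *)
rewrite big_split/= !prod_powR// powRN ler_pdivlMr; last first.
  by apply/powR_gt0/prodr_gt0 => i _; exact: is_sv_unit_gt0 Bb.
rewrite -powRM ?prodr_ge0// mulrC.
rewrite ge0_ler_powR ?nnegrE ?mulr_ge0 ?prodr_ge0 ?(ltW hp)//.
exact: (prod_sv_mul ln hB Aa ABg Bb).
Qed.
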